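(* Let $I \subseteq R = \Bbbk[x_1,\dots,x_n]$ be a monomial ideal. There exists an integer $c \in \mathbb{N}$ such that $$\mathrm{NP}(I^{(c)}) = c\,\mathrm{SP}(I).$$
   Context: $\Bbbk$ is a field, $R = \Bbbk[x_1,\dots,x_n]$, and $\mathbb{N}$ denotes the positive integers. For $\mathbf{a} \in \mathbb{Z}^n_{\ge 0}$, $x^{\mathbf a} = x_1^{a_1}\cdots x_n^{a_n}$. $\mathrm{Ass}(I)$ denotes the set of associated primes of $I$ (i.e. of $R/I$), and $\mathrm{maxAss}(I)$ its maximal elements under inclusion. The $k$-th symbolic power of $I$ is $I^{(k)} = \bigcap_{\mathfrak{p} \in \mathrm{Ass}(I)} (I^k R_{\mathfrak{p}} \cap R)$. The Newton polyhedron $\mathrm{NP}(I)$ of a monomial ideal $I$ is the convex hull in $\mathbb{R}^n$ of $\{\mathbf{a} \in \mathbb{Z}^n_{\ge 0} : x^{\mathbf{a}} \in I\}$ (so $\mathrm{NP}(0)=\emptyset$). The symbolic polyhedron of $I$ is $\mathrm{SP}(I) = \bigcap_{\mathfrak{p} \in \mathrm{maxAss}(I)} \mathrm{NP}(Q_{\subseteq \mathfrak{p}})$, where $Q_{\subseteq \mathfrak{p}} = R \cap I R_{\mathfrak{p}}$. For $I = R$, where these intersections are empty, they are read as $I^{(k)}=R$ and $\mathrm{SP}(I) = \mathbb{R}^n_{\ge 0}$. *)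

(* Defs.v *)
From HB Require Import structures.
From mathcomp Require Import all_boot all_order all_algebra fraction.
From mathcomp Require Import boolp classical_sets reals convex.
From mathcomp Require Import mpoly.

Set Implicit Arguments.
Unset Strict Implicit.
Unset Printing Implicit Defensive.

Import Order.TTheory GRing.Theory Num.Theory.

Local Open Scope classical_set_scope.
Local Open Scope ring_scope.

Section Ideals.
Variable A : comNzRingType.
Implicit Types I J p S : set A.

(* MathComp's [idealr_closed] only describes proper ideals, and the unit ideal
   must be allowed here. *)
Definition is_ideal I :=
  [/\ I 0, (forall u v, I u -> I v -> I (u + v)) &
      (forall a u, I u -> I (a * u))].

Definition is_prime_ideal p :=
  [/\ is_ideal p, ~ p 1 & forall u v, p (u * v) -> p u \/ p v].

(* Finite sums of products l * s with l in L and s in S; when L is a subring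
   this is the L-submodule generated by S. *)
Definition span_over (L S : set A) : set A :=
  [set x | exists m (l s : 'I_m -> A),
     [/\ (forall i, L (l i)), (forall i, S (s i)) & x = \sum_i l i * s i]].

Definition ideal_gen S : set A := span_over setT S.

Definition ideal_pow I (k : nat) : set A :=
  ideal_gen [set x | exists2 f : 'I_k -> A, (forall i, I (f i)) &
                       x = \prod_i f i].

Definition ideal_colon I (f : A) : set A := [set r | I (r * f)].

Definition Ass I : set (set A) :=
  [set p | is_prime_ideal p /\ exists f, p = ideal_colon I f].

Definition maxAss I : set (set A) :=
  [set p | Ass I p /\ forall q, Ass I q -> p `<=` q -> q = p].

End Ideals.

Section Localization.
Variable A : idomainType.
Implicit Types I p : set A.

(* For p prime, the localization A_p is realized as a subring of the fraction
   field of A. *)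
Definition loc_ring p : set {fraction A} :=
  [set z | exists a s, ~ p s /\ z = tofrac a / tofrac s].

(* The extended ideal I A_p. *)
Definition loc_ideal I p : set {fraction A} :=
  span_over (loc_ring p) (@tofrac A @` I).

(* A `&` I A_p; for p in Ass(I) this is Q_{\subseteq p}. *)
Definition loc_contraction I p : set A := @tofrac A @^-1` loc_ideal I p.

(* The empty intersection, which arises for I = A, is setT, i.e. A. *)
Definition symbolic_power I (k : nat) : set A :=
  \bigcap_(p in Ass I) loc_contraction (ideal_pow I k) p.

End Localization.

Section MonomialIdeals.
Variables (K : fieldType) (n : nat).
Implicit Type I : set {mpoly K[n]}.

Definition monomial_ideal I :=
  exists E : set 'X_{1..n},
    I = ideal_gen ((fun a : 'X_{1..n} => 'X_[a] : {mpoly K[n]}) @` E).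

Variable R : realType.

Definition exponent_vector (a : 'X_{1..n}) : 'rV[R]_n := \row_i (a i)%:R.

Definition convex_hull (S : set 'rV[R]_n) : set 'rV[R]_n :=
  smallest (fun C : set 'rV[R]_n => convex_set C) S.

Definition newton_polyhedron I : set 'rV[R]_n :=
  convex_hull (exponent_vector @` [set a | I 'X_[a]]).

Definition nonneg_orthant : set 'rV[R]_n := [set v | forall i, 0 <= v 0 i].

(* The intersection is taken inside the nonnegative orthant, which contains
   every Newton polyhedron; this only matters when I is the unit ideal, where
   maxAss I is empty and the result is the whole orthant. *)
Definition symbolic_polyhedron I : set 'rV[R]_n :=
  nonneg_orthant `&`
  \bigcap_(p in maxAss I) newton_polyhedron (loc_contraction I p).

End MonomialIdeals.

Arguments newton_polyhedron {K n} R I.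
Arguments symbolic_polyhedron {K n} R I.

(* Main.v *)
Require Import Defs.
From mathcomp Require Import all_boot all_order all_algebra fraction.
From mathcomp Require Import interval_inference boolp classical_sets reals convex.
From mathcomp Require Import mpoly.
From mathcomp Require Import ring.

(* At a prime p, a monomial ideal I contracts to a monomial ideal Q_p that
   depends only on the set of variables in p, and the exponents of I^k contracted
   at p are those dominating a sum of k exponents of Q_p. Associated primes of I
   are monomial, hence finitely many and each below a maximal one, so x^a lies in
   I^(k) iff a lies in the k-fold sumset of Q_p for every p in maxAss(I). This
   gives NP(I^(k)) <= k SP(I) for all k.
   For the converse, write x in SP(I) as a point dominating, for each of the
   finitely many Q_p, a convex combination of its (by Dickson, finitely many)
   generators. The point, the weights and the slacks solve a fixed rational
   system in nonnegative unknowns, so they are convex combinations of basic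
   solutions, up to a nonnegative recession vector. Basic solutions are finitely
   many and rational; c is a common denominator. *)

Set Implicit Arguments.
Unset Strict Implicit.
Unset Printing Implicit Defensive.

Import Order.TTheory GRing.Theory Num.Theory.

Local Open Scope classical_set_scope.
Local Open Scope ring_scope.

(** * Rational polyhedra *)

Section RationalPolyhedra.
Variables (R : realType) (T U : finType) (A : T -> U -> rat) (b : U -> rat).
Implicit Types (z d : T -> R) (C : (T -> R) -> Prop).

Definition sol z := forall u, \sum_t z t * ratr (A t u) = ratr (b u).
Definition hom_sol d := forall u, \sum_t d t * ratr (A t u) = 0.

Lemma sol_addM z d (s : R) : sol z -> hom_sol d -> sol (fun t => z t + s * d t).
Proof.
move=> hz hd u; under eq_bigr do rewrite mulrDl -mulrA.
by rewrite big_split/= hz -mulr_sumr hd mulr0 addr0.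
Qed.

Lemma hom_solM d (s : R) : hom_sol d -> hom_sol (fun t => s * d t).
Proof.
move=> hd u; under eq_bigr do rewrite -mulrA.
by rewrite -mulr_sumr hd mulr0.
Qed.

(** Membership of a rational vector in the row space of a rational matrix is unaffected by extending
    scalars to [R]. Zeroing the rows outside [S] enforces the support condition. *)
Lemma rational_sol (S : {set T}) z :
  (forall t, t \notin S -> z t = 0) -> sol z ->
  exists v : T -> rat, (forall t, t \notin S -> v t = 0) /\
    sol (fun t => ratr (v t)).
Proof.
move=> zS hz.
pose A' : 'M[rat]_(#|T|, #|U|) :=
  \matrix_(i, j) if enum_val i \in S then A (enum_val i) (enum_val j) else 0.
pose b' : 'rV[rat]_#|U| := \row_j b (enum_val j).
have : (map_mx (@ratr R) b' <= map_mx (@ratr R) A')%MS.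
  apply/submxP; exists (\row_i z (enum_val i)); apply/rowP => j.
  rewrite !mxE -hz (reindex _ (onW_bij _ (enum_val_bij T)))/=.
  apply: eq_bigr => i _; rewrite !mxE/=.
  by case: ifPn => // /zS ->; rewrite mul0r rmorph0 mulr0.
rewrite map_submx => /submxP[w ew].
exists (fun t => if t \in S then w 0 (enum_rank t) else 0); split.
  by move=> t /negbTE ->.
move=> u; have := congr1 (fun M : 'rV_#|U| => M 0 (enum_rank u)) ew.
rewrite !mxE enum_rankK => ->; rewrite rmorph_sum/=.
rewrite (reindex _ (onW_bij _ (enum_val_bij T)))/=.
apply: eq_bigr => i _; rewrite !mxE/= enum_valK enum_rankK -rmorphM/=.
by case: ifP; rewrite ?mulr0 ?mul0r.
Qed.

(** Linear independence over [R] of the rows [A t] with t in [S]; nonnegative solutions with such a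
    support are the basic solutions. *)
Definition indep (S : {set T}) :=
  forall d, hom_sol d -> (forall t, t \notin S -> d t = 0) -> forall t, d t = 0.

Lemma common_denominator (v : T -> rat) :
  exists2 D : nat, (0 < D)%N & forall t, exists k : int, v t * D%:R = k%:~R.
Proof.
exists (\prod_t `|denq (v t)|)%N.
  by rewrite prodn_gt0// => t; rewrite absz_gt0 denq_neq0.
move=> t; rewrite (bigD1 t)//= natrM mulrA.
exists (numq (v t) * (\prod_(i | i != t) `|denq (v i)|)%N%:Z).
rewrite intrM; congr (_ * _).
have -> : (`|denq (v t)|%N)%:R = (denq (v t))%:~R :> rat.
  by rewrite -[in RHS]absz_denq.
by rewrite -{1}(divq_num_den (v t)) divfK// intr_eq0 denq_neq0.
Qed.

(** An independent support carries at most one solution, and [rational_sol] makes it rational, so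
    clearing its denominators serves every z. *)
Lemma basic_denominator (S : {set T}) : indep S ->
  exists2 D : nat, (0 < D)%N & forall z, (forall t, 0 <= z t) -> sol z ->
    (forall t, t \notin S -> z t = 0) ->
    exists u : T -> nat, forall t, z t * D%:R = (u t)%:R.
Proof.
move=> iS.
have [[z [hz zS]]|] := pselect (exists z, sol z /\
    (forall t, t \notin S -> z t = 0)); last first.
  by move=> nz; exists 1%N => // z _ hz zS; case: nz; exists z.
have [v [vS hv]] := rational_sol zS hz.
have [D D0 hD] := common_denominator v.
exists D => // y y0 hy yS.
have yE t : y t = ratr (v t).
  apply/eqP; rewrite -subr_eq0; apply/eqP.
  apply: (iS (fun t => y t - ratr (v t))).
    move=> u; under eq_bigr do rewrite mulrBl.
    by rewrite sumrB hy hv subrr.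
  by move=> i iS'; rewrite yS// vS// rmorph0 subrr.
suff /choice[u hu] : forall t, exists m : nat, y t * D%:R = m%:R by exists u.
move=> t; have [k hk] := hD t.
have := mulr_ge0 (y0 t) (ler0n R D).
have -> : y t * D%:R = k%:~R.
  by rewrite yE -(ratr_nat R D) -rmorphM/= hk ratr_int.
by rewrite ler0z; case: k {hk} => // m _; exists m.
Qed.

Lemma decrease_support z d : (forall t, 0 <= z t) ->
  (forall t, z t = 0 -> d t = 0) -> (exists t, d t < 0) ->
  exists s : R, [/\ 0 < s, forall t, 0 <= z t + s * d t &
    exists2 t, z t != 0 & z t + s * d t = 0].
Proof.
move=> z0 zd [t0 dt0].
(* The ratio test of the simplex method: the smallest ratio is the largest step along [d] that keeps
   all coordinates nonnegative, and the minimizing coordinate becomes 0. *)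
case: (@arg_minP _ _ _ t0 (fun t => d t < 0) (fun t => z t / - d t) dt0)
  => t dt hmin.
have zt : z t != 0 by apply/eqP => /zd e; rewrite e ltxx in dt.
have ztp : 0 < z t by rewrite lt_def zt z0.
have ndt : 0 < - d t by rewrite oppr_gt0.
exists (z t / - d t); split; first exact: divr_gt0.
  move=> j; have [dj|dj] := ltP (d j) 0; last first.
    by rewrite addr_ge0// mulr_ge0// ltW// divr_gt0.
  have := hmin j dj; rewrite ler_pdivlMr ?oppr_gt0// => h.
  by rewrite -lerBlDr sub0r -mulrN.
exists t => //; rewrite invrN mulrN mulNr divfK ?subrr//.
by rewrite lt_eqF.
Qed.

Definition convexf C := forall x y (t : R), 0 <= t -> t <= 1 -> C x -> C y ->
  C (fun j => t * x j + (1 - t) * y j).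

(* A feasible point whose support is dependent lies on a segment, or on a
   recession ray, with endpoints feasible and of smaller support. *)
Lemma sol_ind C : convexf C ->
  (forall z d, C z -> (forall t, 0 <= d t) -> hom_sol d ->
     C (fun t => z t + d t)) ->
  (forall z, (forall t, 0 <= z t) -> sol z -> indep [set t | z t != 0]%SET ->
     C z) ->
  forall z, (forall t, 0 <= z t) -> sol z -> C z.
Proof.
move=> Cconv Crec Cbase z.
have [k] := ubnP #|[set t | z t != 0]%SET|; elim: k z => // k IH z + z0 hz.
rewrite ltnS => kz.
have [iS|nS] := pselect (indep [set t | z t != 0]%SET); first exact: Cbase.
have [d [hd dS [t dt]]] : exists d, [/\ hom_sol d,
    forall t, z t = 0 -> d t = 0 & exists t, d t != 0].
  apply: contrapT => h; apply: nS => d hd dS t; apply: contrapT => dt; apply: h.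
  exists d; split => //; last by exists t; apply/eqP.
  by move=> j zj; apply: dS; rewrite inE zj eqxx.
have move_ e : hom_sol e -> (forall t, z t = 0 -> e t = 0) ->
    (exists t, e t < 0) -> exists2 s : R, 0 < s & C (fun t => z t + s * e t).
  move=> he eS ne; have [s [s0 se [j zj ej]]] := decrease_support z0 eS ne.
  exists s => //; apply: IH => //; last exact: sol_addM.
  apply: leq_trans kz; apply: proper_card; apply/properP; split.
    apply/fintype.subsetP => i; rewrite !inE; apply: contraNN => /eqP zi.
    by rewrite zi eS// mulr0 addr0.
  by exists j; rewrite inE// ej eqxx.
have hd' : hom_sol (fun t => - d t).
  by move=> u; under eq_bigr do rewrite mulNr; rewrite sumrN hd oppr0.
have dS' i : z i = 0 -> - d i = 0 by move=> /dS ->; rewrite oppr0.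
(* If [d] has constant sign, z is one endpoint plus a nonnegative recession vector; otherwise z lies
   between endpoints reached along [d] and [- d]. *)
have [[i di]|nneg] := pselect (exists i, d i < 0); last first.
  have d0 i : 0 <= d i.
    by rewrite leNgt; apply/negP => di; apply: nneg; exists i.
  have [|s s0 Cs] := move_ _ hd' dS'.
    by exists t; rewrite oppr_lt0 lt_def dt d0.
  rewrite (_ : z = fun t => (z t + s * - d t) + s * d t); last first.
    by apply/funext => j; ring.
  by apply: Crec => //; [move=> j; rewrite mulr_ge0// ltW|exact: hom_solM].
have [s s0 Cs] := move_ _ hd dS (ex_intro _ i di).
have [[j dj]|npos] := pselect (exists j, 0 < d j); last first.
  rewrite (_ : z = fun t => (z t + s * d t) + s * - d t); last first.
    by apply/funext => j; ring.
  apply: Crec => //; last exact: hom_solM.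
  move=> j; rewrite mulr_ge0 ?(ltW s0)// oppr_ge0.
  by rewrite leNgt; apply/negP => dj; apply: npos; exists j.
have [|r r0 Cr] := move_ _ hd' dS'; first by exists j; rewrite oppr_lt0.
have sr : s + r != 0 by rewrite gt_eqF// addr_gt0.
rewrite (_ : z = fun j => r / (s + r) * (z j + s * d j) +
   (1 - r / (s + r)) * (z j + r * - d j)); last first.
  by apply/funext => l; field.
apply: Cconv => //; first by rewrite divr_ge0 ?addr_ge0 ?ltW.
by rewrite ler_pdivrMr ?addr_gt0// mul1r lerDr ltW.
Qed.

(** An induction principle for feasible points, with [D] chosen before the predicate [C]. There are
    finitely many supports, so the product of their denominators serves all basic solutions at
    once. *)
Lemma rational_polyhedron : exists2 D : nat, (0 < D)%N & forall C, convexf C ->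
  (forall z d, C z -> (forall t, 0 <= d t) -> hom_sol d ->
     C (fun t => z t + d t)) ->
  (forall (z : T -> R) (u : T -> nat), sol z ->
     (forall t, z t * D%:R = (u t)%:R) -> C z) ->
  forall z, (forall t, 0 <= z t) -> sol z -> C z.
Proof.
have /choice[D hD] : forall S : {set T}, exists D : nat, (0 < D)%N /\
    (indep S -> forall z, (forall t, 0 <= z t) -> sol z ->
      (forall t, t \notin S -> z t = 0) ->
      exists u : T -> nat, forall t, z t * D%:R = (u t)%:R).
  move=> S; have [iS|niS] := pselect (indep S); last by exists 1%N.
  by have [D D0 h] := basic_denominator iS; exists D.
exists (\prod_S D S)%N; first by rewrite prodn_gt0// => S; case: (hD S).
move=> C Cconv Crec Cint; apply: sol_ind => // z z0 hz iS.
move: iS; set S := [set t | z t != 0]%SET => iS.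
have [_ /(_ iS z z0 hz)[|u hu]] := hD S.
  by move=> t; rewrite inE negbK => /eqP.
apply: (Cint _ (fun t => (u t * \prod_(S' | S' != S) D S')%N) hz) => t.
by rewrite (bigD1 S)//= !natrM mulrA hu.
Qed.

End RationalPolyhedra.

(** * Convex hulls of exponent sets *)

Section ConvexHulls.
Variables (R : realType) (n : nat).
Local Notation V := 'rV[R]_n.
Implicit Types (S C : set V) (Q : set 'X_{1..n}).

Lemma convex_setP C : convex_set C <->
  forall x y (t : R), 0 <= t -> t <= 1 -> C x -> C y -> C (t *: x + (1 - t) *: y).
Proof.
split=> [cC x y t t0 t1 Cx Cy|cC x y t xC yC].
  by have := cC x y (Itv01 t0 t1) (mem_set Cx) (mem_set Cy); rewrite inE.
by apply/mem_set/cC; [exact: ge0|exact: le1|exact: set_mem|exact: set_mem].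
Qed.

Lemma sub_convex_hull S : S `<=` convex_hull S.
Proof. by move=> x Sx C [_]; apply. Qed.

Lemma convex_hull_min S C : convex_set C -> S `<=` C -> convex_hull S `<=` C.
Proof. by move=> cC SC x; apply. Qed.

Lemma convex_convex_hull S : convex_set (convex_hull S).
Proof.
apply/convex_setP => x y t t0 t1 hx hy C [cC SC].
by move/convex_setP : (cC); apply => //; [exact: hx|exact: hy].
Qed.

Lemma convex_setZ S (c : R) : convex_set S ->
  convex_set [set x : V | S (c *: x)].
Proof.
move=> /convex_setP cS; apply/convex_setP => x y t t0 t1 /= hx hy.
by rewrite scalerDr !scalerA ![c * _]mulrC -!scalerA; exact: cS.
Qed.

Lemma convex_set_sum C (I : eqType) (s : seq I) (l : I -> R) (x : I -> V) :
  convex_set C -> (forall i, i \in s -> 0 <= l i) ->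
  (forall i, i \in s -> C (x i)) -> \sum_(i <- s) l i = 1 ->
  C (\sum_(i <- s) l i *: x i).
Proof.
move=> /convex_setP cC.
(* The tail of a convex combination need not have total weight 1; dividing by the total weight gives
   a statement that passes to tails. *)
suff H : (forall i, i \in s -> 0 <= l i) -> (forall i, i \in s -> C (x i)) ->
    \sum_(i <- s) l i != 0 ->
    C ((\sum_(i <- s) l i)^-1 *: \sum_(i <- s) l i *: x i).
  move=> l0 Cx l1; have := H l0 Cx; rewrite l1 oner_eq0 invr1 scale1r.
  exact.
elim: s => [|j s IH] l0 Cx; first by rewrite big_nil eqxx.
rewrite !big_cons.
have lj0 : 0 <= l j by apply: l0; rewrite mem_head.
have Cxj : C (x j) by apply: Cx; rewrite mem_head.
have l0' i : i \in s -> 0 <= l i by move=> si; rewrite l0// inE si orbT.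
have Cx' i : i \in s -> C (x i) by move=> si; apply: Cx; rewrite inE si orbT.
have {IH} := IH l0' Cx'.
have : 0 <= \sum_(i <- s) l i by rewrite big_seq; exact: sumr_ge0.
have [s0 _ _|s0] := eqVneq (\sum_(i <- s) l i) 0.
  have -> : \sum_(i <- s) l i *: x i = 0.
    rewrite big_seq big1// => i si.
    move/eqP: s0; rewrite big_seq psumr_eq0// => /allP/(_ i si).
    by rewrite si/= => /eqP ->; rewrite scale0r.
  by rewrite s0 !addr0 => lj; rewrite scalerA mulVf// scale1r.
set L := \sum_(i <- s) l i in s0 *; move=> L0 /(_ isT) CL lL.
have lLp : 0 < l j + L by rewrite ltr_wpDl// lt_def s0.
rewrite (_ : _^-1 *: _ = (l j / (l j + L)) *: x j + (1 - l j / (l j + L)) *: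
    (L^-1 *: (\sum_(i <- s) l i *: x i))); last first.
  rewrite scalerDr !scalerA [_^-1 * l j]mulrC; congr (_ + _ *: _).
  by field; rewrite s0.
apply: cC => //; first by rewrite divr_ge0// ltW.
by rewrite ler_pdivrMr// mul1r lerDl.
Qed.

Definition up_closed Q := forall a b, Q a -> (a <= b)%MM -> Q b.

(** One coordinate direction is added at a time. By convexity it is enough to move an exponent a of
    [Q], and the moved point lies on the segment from a to a far integral translate of a, which is
    again in [Q]. *)
Lemma convex_hull_up_closed Q (v w : V) : up_closed Q ->
  convex_hull (exponent_vector R @` Q) v -> (forall i, 0 <= w 0 i) ->
  convex_hull (exponent_vector R @` Q) (v + w).
Proof.
move=> Qup; set H := convex_hull _ => Hv w0.
have /convex_setP cH : convex_set H := @convex_convex_hull _.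
have step i (t : R) u : 0 <= t -> H u -> H (u + t *: delta_mx 0 i).
  move=> t0; move: u.
  apply: (@convex_hull_min _ [set u | H (u + t *: delta_mx 0 i)]).
    apply/convex_setP => x y s s0 s1 /= hx hy.
    rewrite (_ : _ + _ = s *: (x + t *: delta_mx 0 i) +
      (1 - s) *: (y + t *: delta_mx 0 i)); first exact: cH.
    rewrite !scalerDr addrACA -scalerDl addrCA subrr addr0 scale1r.
    by [].
  move=> _ [a Qa <-] /=.
  (* The bound makes t / N at most 1; the successor keeps N nonzero. *)
  pose N := (Num.bound t).+1.
  have tN : t / N%:R <= 1.
    rewrite ler_pdivrMr ?ltr0n// mul1r ltW//.
    have := archi_boundP t0 => /lt_le_trans; apply.
    by rewrite ler_nat.
  rewrite (_ : _ + _ = (t / N%:R) *: exponent_vector R (a + U_(i) *+ N)%MM +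
     (1 - t / N%:R) *: exponent_vector R a); last first.
    apply/rowP => k; rewrite !mxE mnmDE mulmnE mnm1E natrD natrM/= eq_sym.
    by case: eqP => _; field; rewrite pnatr_eq0.
  apply: cH => //; first by rewrite divr_ge0.
    apply: sub_convex_hull; exists (a + U_(i) *+ N)%MM => //.
    by apply: Qup Qa _; exact: lem_addr.
  by apply: sub_convex_hull; exists a.
rewrite [w]row_sum_delta.
elim: (index_enum _) => [|i s IH]; first by rewrite big_nil addr0.
by rewrite big_cons addrCA addrC; apply: step.
Qed.

(** For the exponents of a monomial ideal, these are the exponents of its k-th power; k = 0 gives
    all exponents, as for the unit ideal. *)
Definition minkowski_pow Q (k : nat) : set 'X_{1..n} :=
  [set a | exists s : seq 'X_{1..n}, [/\ size s = k,
    forall m, m \in s -> Q m & ((\sum_(m <- s) m)%MM <= a)%MM]].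

Lemma up_closed_minkowski_pow Q k : up_closed (minkowski_pow Q k).
Proof.
move=> a b [s [sk sQ sa]] ab; exists s; split => //; exact: lepm_trans sa ab.
Qed.

(** The average of k exponents lies in the hull, and the scaled excess of a over their sum is
    absorbed by [convex_hull_up_closed]. *)
Lemma minkowski_pow_sub Q k a : up_closed Q -> (0 < k)%N ->
  minkowski_pow Q k a ->
  convex_hull (exponent_vector R @` Q) (k%:R^-1 *: exponent_vector R a).
Proof.
move=> Qup k0 [s [sk sQ /mnm_lepP sa]].
have kR : k%:R != 0 :> R by rewrite pnatr_eq0 -lt0n.
have sumE : exponent_vector R (\sum_(m <- s) m)%MM =
    \sum_(m <- s) exponent_vector R m.
  apply/rowP => i; rewrite mxE mnm_sumE natr_sum summxE.
  by apply: eq_bigr => m _; rewrite mxE.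
rewrite (_ : _ *: _ = \sum_(m <- s) k%:R^-1 *: exponent_vector R m +
  (k%:R^-1 *: (exponent_vector R a - exponent_vector R (\sum_(m <- s) m)%MM)));
  last by rewrite -scaler_sumr -sumE -scalerDr addrCA subrr addr0.
apply: convex_hull_up_closed => //.
  apply: convex_set_sum; first exact: convex_convex_hull.
  - by move=> i _; rewrite invr_ge0.
  - by move=> i si; apply: sub_convex_hull; exists i => //; exact: sQ.
  - by rewrite big_const_seq count_predT sk iter_addr_0 -[LHS]mulr_natr mulVf.
by move=> i; rewrite !mxE mulr_ge0 ?invr_ge0// subr_ge0 ler_nat.
Qed.

Lemma dickson Q : exists F : seq 'X_{1..n}, (forall f, f \in F -> Q f) /\
  forall a, Q a -> exists2 f, f \in F & (f <= a)%MM.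
Proof.
(* Domination is only asked on a list of coordinates, which allows induction on that list for all
   [Q]. *)
suff [F [FQ hF]] : exists F : seq 'X_{1..n}, (forall f, f \in F -> Q f) /\
    forall a, Q a -> exists2 f, f \in F &
      forall i, i \in enum 'I_n -> (f i <= a i)%N.
  exists F; split=> // a /hF[f Ff fa]; exists f => //.
  by apply/mnm_lepP => i; apply: fa; rewrite mem_enum.
elim: (enum _) Q => [|t s IH] Q.
  have [[a Qa]|nQ] := pselect (exists a, Q a).
    exists [:: a]; split=> [f|b _]; first by rewrite inE => /eqP ->.
    by exists a; rewrite ?mem_head.
  by exists [::]; split=> // a Qa; case: nQ; exists a.
have [F0 [F0Q hF0]] := IH Q.
(* [F0] ignores coordinate t, but still dominates from below once a t is at least M. Each of the
   finitely many slices with a t = j < M gets its own list. *)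
pose M := (\max_(f <- F0) f t)%N.
have /choice[F hF] := fun j => IH [set a | Q a /\ a t = j].
exists (F0 ++ flatten [seq F j | j <- iota 0 M]); split.
  move=> f; rewrite mem_cat => /orP[|/flattenP[_ /mapP[j _ ->]]]; first exact: F0Q.
  by case: (hF j) => h _ /h [].
move=> a Qa; have [aM|aM] := ltnP (a t) M; last first.
  have [f fF fa] := hF0 a Qa; exists f; first by rewrite mem_cat fF.
  move=> i; rewrite inE => /predU1P[->|]; last exact: fa.
  by apply: leq_trans aM; exact: leq_bigmax_seq.
have [_ /(_ a)[|f fF fa]] := hF (a t); first by split.
exists f.
  rewrite mem_cat; apply/orP; right; apply/flattenP; exists (F (a t)) => //.
  by apply: map_f; rewrite mem_iota.
move=> i; rewrite inE => /predU1P[->|]; last exact: fa.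
by case: (hF (a t)) => /(_ f fF)[_ ->].
Qed.

(** A total sequence with values in [Q] allows the bound to be enlarged later to one common to
    several sets. *)
Lemma dickson_sequence Q : Q !=set0 -> exists (B : nat) (e : nat -> 'X_{1..n}),
  (forall k, Q (e k)) /\
  forall a, Q a -> exists2 k, (k < B)%N & (e k <= a)%MM.
Proof.
move=> [q Qq]; have [F [FQ hF]] := dickson Q.
exists (size F), (nth q F); split.
  move=> k; have [kF|kF] := ltnP k (size F); first exact/FQ/mem_nth.
  by rewrite nth_default.
move=> a /hF[f fF fa]; exists (index f F); first by rewrite index_mem.
by rewrite nth_index.
Qed.

(** The points dominating a convex combination of the generators form a convex set containing the
    exponents of [Q]. *)
Lemma convex_hull_domination Q (B : nat) (e : nat -> 'X_{1..n}) :
  (forall a, Q a -> exists2 k, (k < B)%N & (e k <= a)%MM) ->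
  forall x, convex_hull (exponent_vector R @` Q) x ->
  exists l : 'I_B -> R, [/\ forall k, 0 <= l k, \sum_k l k = 1 &
    forall i, \sum_k l k * (e k i)%:R <= x 0 i].
Proof.
move=> he; apply: (@convex_hull_min _ [set x : V | exists l : 'I_B -> R,
  [/\ forall k, 0 <= l k, \sum_k l k = 1 &
    forall i, \sum_k l k * (e k i)%:R <= x 0 i]]); last first.
  move=> _ [a /he[k kB /mnm_lepP ka] <-].
  exists (fun j => (j == Ordinal kB)%:R); split.
  - by move=> j; rewrite ler0n.
  - rewrite (bigD1 (Ordinal kB))//= eqxx big1 ?addr0// => j /negbTE ->.
    by [].
  - move=> i; rewrite (bigD1 (Ordinal kB))//= eqxx mul1r big1 ?addr0.
      by rewrite mxE ler_nat.
    by move=> j /negbTE ->; rewrite mul0r.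
apply/convex_setP => x y t t0 t1 [l [l0 l1 lx]] [m [m0 m1 my]].
exists (fun k => t * l k + (1 - t) * m k); split.
- by move=> k; rewrite addr_ge0// mulr_ge0// subr_ge0.
- by rewrite big_split/= -!mulr_sumr l1 m1; ring.
- move=> i; under eq_bigr do rewrite mulrDl -!mulrA.
  rewrite big_split/= -!mulr_sumr !mxE.
  by rewrite lerD// ler_wpM2l// subr_ge0.
Qed.

End ConvexHulls.

(** * One scaling factor for finitely many exponent sets *)

Section UniformScaling.
Variables (R : realType) (n : nat) (J : finType) (Q : J -> set 'X_{1..n}).
Local Notation V := 'rV[R]_n.

Section System.
Variables (B : nat) (e : J -> nat -> 'X_{1..n}).

(* Unknowns: the weights of the generators e j k, the slacks, and the point x;
   equations: x_i = slack + weighted sum of the (e j k)_i, weights sum to 1. *)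
Definition unknown := ((J * 'I_B + J * 'I_n) + 'I_n)%type.
Definition equation := (J * 'I_n + J)%type.

Definition sys_coef (t : unknown) (u : equation) : rat :=
  match t, u with
  | inl (inl (j, k)), inl (j', i) => if j == j' then (e j k i)%:R else 0
  | inl (inr ji), inl ji' => if ji == ji' then 1 else 0
  | inr i, inl (_, i') => if i == i' then -1 else 0
  | inl (inl (j, _)), inr j' => if j == j' then 1 else 0
  | _, inr _ => 0
  end.

Definition sys_rhs (u : equation) : rat := if u is inr _ then 1 else 0.

Lemma sum_sys_inl (z : unknown -> R) j i :
  \sum_t z t * ratr (sys_coef t (inl (j, i))) =
  \sum_k z (inl (inl (j, k))) * (e j k i)%:R + z (inl (inr (j, i))) - z (inr i).
Proof.
rewrite !big_sumType/=; congr (_ + _ + _).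
- rewrite (eq_bigr (fun p => if p.1 == j
      then z (inl (inl (p.1, p.2))) * (e p.1 p.2 i)%:R else 0)); last first.
    by move=> [j' k] _ /=; case: ifP; rewrite ?rmorph_nat ?rmorph0 ?mulr0.
  rewrite -(pair_bigA _ (fun j' k =>
     if j' == j then z (inl (inl (j', k))) * (e j' k i)%:R else 0))/=.
  rewrite (bigD1 j)//= eqxx [X in _ + X]big1 ?addr0// => j' /negbTE ->.
  by rewrite big1.
- rewrite (bigD1 (j, i))//= eqxx rmorph1 mulr1 big1 ?addr0// => t /negbTE ->.
  by rewrite rmorph0 mulr0.
- rewrite (bigD1 i)//= eqxx rmorphN rmorph1 mulrN1 big1 ?addr0// => t /negbTE ->.
  by rewrite rmorph0 mulr0.
Qed.

Lemma sum_sys_inr (z : unknown -> R) j :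
  \sum_t z t * ratr (sys_coef t (inr j)) = \sum_k z (inl (inl (j, k))).
Proof.
rewrite !big_sumType/= [X in _ + X]big1 ?addr0; last first.
  by move=> i _; rewrite rmorph0 mulr0.
rewrite [X in _ + X]big1 ?addr0; last by move=> i _; rewrite rmorph0 mulr0.
rewrite (eq_bigr (fun p =>
    if p.1 == j then z (inl (inl (p.1, p.2))) else 0)); last first.
  by move=> [j' k] _ /=; case: ifP; rewrite ?rmorph1 ?mulr1 ?rmorph0 ?mulr0.
rewrite -(pair_bigA _ (fun j' k =>
   if j' == j then z (inl (inl (j', k))) else 0))/=.
rewrite (bigD1 j)//= eqxx [X in _ + X]big1 ?addr0// => j' /negbTE ->.
by rewrite big1.
Qed.

Lemma sys_solP (z : unknown -> R) : sol sys_coef sys_rhs z <->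
  (forall j i, \sum_k z (inl (inl (j, k))) * (e j k i)%:R +
     z (inl (inr (j, i))) = z (inr i)) /\
  (forall j, \sum_k z (inl (inl (j, k))) = 1).
Proof.
split=> [hz|[h1 h2] [[j i]|j]]; [split=> [j i|j]| |].
- apply/eqP; rewrite -subr_eq0 -sum_sys_inl; apply/eqP.
  by rewrite hz rmorph0.
- by rewrite -sum_sys_inr hz rmorph1.
- by rewrite sum_sys_inl h1 subrr rmorph0.
- by rewrite sum_sys_inr h2 rmorph1.
Qed.

Lemma weighted_minkowski_pow (u : 'I_B -> nat) j (a : 'X_{1..n}) (D : nat) :
  (forall k, Q j (e j k)) -> (\sum_k u k)%N = D ->
  (forall i, (\sum_k u k * e j k i <= a i)%N) -> minkowski_pow (Q j) D a.
Proof.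
move=> eQ uD ua; exists (flatten [seq nseq (u k) (e j k) | k <- index_enum 'I_B]).
split.
- rewrite size_flatten sumnE !big_map -uD.
  by apply: eq_bigr => k _; rewrite size_nseq.
- by move=> m /flattenP[_ /mapP[k _ ->]]; rewrite mem_nseq => /andP[_ /eqP ->].
- apply/mnm_lepP => i; apply: leq_trans (ua i).
  rewrite mnm_sumE big_flatten big_map.
  apply: eq_leq; apply: eq_bigr => k _.
  by rewrite big_nseq iter_addn_0 mulnC.
Qed.

End System.

Lemma uniform_scaling : exists2 c : nat, (0 < c)%N &
  forall x : V, (forall i, 0 <= x 0 i) ->
  (forall j, convex_hull (exponent_vector R @` Q j) x) ->
  convex_hull (exponent_vector R @` [set a | forall j, minkowski_pow (Q j) c a])
    (c%:R *: x).
Proof.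
(* If some [Q j] is empty, so is its hull, and no x satisfies the hypotheses. *)
have [Q0|/existsNP[j /nonemptyPn Qj]] := pselect (forall j, Q j !=set0); last first.
  exists 1%N => // x _ /(_ j).
  rewrite Qj image_set0 => /(_ set0)[]; split=> //; apply/convex_setP => ? ? ? _ _ [].
have /choice[B /choice[e he]] := fun j => dickson_sequence (Q0 j).
have eQ j k : Q j (e j k) by case: (he j).
pose b := (\max_j B j)%N.
have eb j a : Q j a -> exists2 k, (k < b)%N & (e j k <= a)%MM.
  case: (he j) => _ h /h[k kB ka]; exists k => //.
  exact: leq_trans kB (leq_bigmax j).
have [c c0 hc] := rational_polyhedron R (@sys_coef b e) sys_rhs.
exists c => // x x0 hx; set P := [set a | _].
have Pup : up_closed P.
  by move=> a a' Pa aa' j; exact: up_closed_minkowski_pow (Pa j) aa'.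
have /choice[l hl] := fun j => convex_hull_domination (eb j) (hx j).
pose z (t : unknown b) : R := match t with
  | inl (inl (j, k)) => l j k
  | inl (inr (j, i)) => x 0 i - \sum_k l j k * (e j k i)%:R
  | inr i => x 0 i
  end.
pose C (z : unknown b -> R) : Prop :=
  convex_hull (exponent_vector R @` P) (c%:R *: \row_i z (inr i)).
have -> : x = \row_i z (inr i) by apply/rowP => i; rewrite mxE.
apply: (hc C).
- move=> y y' t t0 t1 Cy Cy'; rewrite /C.
  have /convex_setP/(_ _ _ _ t0 t1 Cy Cy') := @convex_setZ _ _ _ c%:R
    (@convex_convex_hull R n (exponent_vector R @` P)).
  congr (convex_hull _ (_ *: _)).
  by apply/rowP => i; rewrite !mxE.
- move=> y d Cy d0 _; rewrite /C.
  rewrite (_ : _ *: _ = c%:R *: \row_i y (inr i) + c%:R *: \row_i d (inr i)).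
    by apply: convex_hull_up_closed => // i; rewrite !mxE mulr_ge0.
  by rewrite -scalerDr; congr (_ *: _); apply/rowP => i; rewrite !mxE.
(* After scaling by c, the point is an exponent and the weights are multiplicities adding up to c.
   The scaled slacks are natural numbers, so this exponent dominates the sum of c generators, for
   every j. *)
- move=> y u /sys_solP[ya y1] yu; apply: sub_convex_hull.
  exists [multinom u (inr i) | i < n]; last first.
    by apply/rowP => i; rewrite !mxE mnmE mulrC yu.
  move=> j; apply: (@weighted_minkowski_pow b e (fun k => u (inl (inl (j, k))))).
  + exact: eQ.
  + apply/eqP; rewrite -(eqr_nat R) natr_sum; apply/eqP.
    under eq_bigr do rewrite -yu.
    by rewrite -mulr_suml y1 mul1r.
  + move=> i; rewrite mnmE -(ler_nat R) -yu -(ya j) mulrDl natr_sum mulr_suml.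
    rewrite yu; apply: ler_wpDr => //; apply: ler_sum => k _.
    by rewrite natrM -yu mulrAC.
- move=> [[[j k]|[j i]]|i] //=; last by rewrite subr_ge0; case: (hl j).
  by case: (hl j).
- apply/sys_solP; split=> [j i|j] /=; last by case: (hl j).
  by rewrite addrC subrK.
Qed.

End UniformScaling.

(** * Localizations of monomial ideals *)

Section IdealTheory.
Variable A : comNzRingType.
Implicit Types I p S : set A.

Lemma ideal_sum I (T : Type) (r : seq T) (P : pred T) (F : T -> A) :
  is_ideal I -> (forall i, P i -> I (F i)) -> I (\sum_(i <- r | P i) F i).
Proof. by case=> I0 ID _ IF; apply: big_ind. Qed.

Lemma idealB I u v : is_ideal I -> I u -> I v -> I (u - v).
Proof.
by case=> _ ID IM Iu Iv; apply: ID => //; rewrite -mulN1r; exact: IM.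
Qed.

Lemma sub_ideal_gen S : S `<=` ideal_gen S.
Proof.
move=> x Sx; exists 1%N, (fun=> 1), (fun=> x); split=> //.
by rewrite big_ord1 mul1r.
Qed.

Lemma ideal_gen_is_ideal S : is_ideal (ideal_gen S).
Proof.
split.
- exists 0%N, (fun=> 0), (fun=> 0); split=> // [[]//|].
  by rewrite big_ord0.
- move=> _ _ [k [l [s [_ sS ->]]]] [k' [l' [s' [_ s'S ->]]]].
  pose glue (f : 'I_k -> A) (f' : 'I_k' -> A) (i : 'I_(k + k')) :=
    match split i with inl j => f j | inr j => f' j end.
  exists (k + k')%N, (glue l l'), (glue s s'); split=> //.
    by move=> i; rewrite /glue; case: split.
  rewrite big_split_ord/=; congr (_ + _); apply: eq_bigr => i _;
    rewrite /glue; [have := unsplitK (inl i : 'I_k + 'I_k')%type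
      | have := unsplitK (inr i : 'I_k + 'I_k')%type]; by move=> /= ->.
- move=> a _ [k [l [s [_ sS ->]]]]; exists k, (fun i => a * l i), s.
  by split=> //; rewrite mulr_sumr; apply: eq_bigr => i _; rewrite mulrA.
Qed.

Lemma prime_ideal_prod p (T : eqType) (r : seq T) (F : T -> A) :
  is_prime_ideal p -> p (\prod_(i <- r) F i) -> exists2 i, i \in r & p (F i).
Proof.
move=> [_ p1 pM]; elim: r => [|i r IH]; first by rewrite big_nil.
rewrite big_cons => /pM[pi|/IH[j jr pj]]; first by exists i; rewrite ?mem_head.
by exists j => //; rewrite inE jr orbT.
Qed.

Lemma prime_idealX p u k : is_prime_ideal p -> p (u ^+ k) -> p u.
Proof.
move=> [_ p1 pM]; elim: k => [|k IH]; first by rewrite expr0.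
by rewrite exprS => /pM[].
Qed.

End IdealTheory.

(** A finite sum of fractions has a common denominator, which stays outside the prime p. *)
Lemma loc_contractionP (A : idomainType) (I p : set A) (r : A) :
  is_ideal I -> is_prime_ideal p ->
  loc_contraction I p r <-> exists2 s, ~ p s & I (s * r).
Proof.
move=> [I0 ID IM] [[p0 _ _] p1 pM]; split; last first.
  move=> [s ps Isr]; exists 1%N, (fun=> (tofrac s)^-1), (fun=> tofrac (s * r)).
  split=> [_|_|]; first by exists 1, s; rewrite tofrac1 div1r.
    by exists (s * r).
  rewrite big_ord1 tofracM mulKf// tofrac_eq0.
  by apply/eqP => s0; apply: ps; rewrite s0.
move=> [k [l [u [lp uI er]]]].
suff [s [v [ps Iv e]]] : exists s v, [/\ ~ p s, I v &
    \sum_i l i * u i = tofrac v / tofrac s].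
  exists s => //; suff -> : s * r = v by [].
  have s0 : tofrac s != 0.
    by rewrite tofrac_eq0; apply/eqP => s0; apply: ps; rewrite s0.
  by apply/eqP; rewrite -tofrac_eq tofracM er e mulrC divfK.
elim: (index_enum _) => [|i t [s [v [ps Iv e]]]].
  by exists 1, 0; split=> //; rewrite big_nil tofrac0 mul0r.
have [a [q [pq la]]] := lp i; have [w Iw wu] := uI i.
exists (q * s), (a * (s * w) + q * v); split.
- by case/pM.
- by apply: (ID); apply: (IM) => //; exact: IM.
- rewrite big_cons e la -wu tofracD !tofracM.
  have q0 : tofrac q != 0.
    by rewrite tofrac_eq0; apply/eqP => q0; apply: pq; rewrite q0.
  have s0 : tofrac s != 0.
    by rewrite tofrac_eq0; apply/eqP => s0; apply: ps; rewrite s0.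
  by rewrite mulrAC addf_div// [tofrac v * _]mulrC -mulrA [tofrac w * _]mulrC.
Qed.

(** * Exponents of monomial ideals, their powers and contractions *)

Section MonomialTheory.
Variables (K : fieldType) (n : nat).
Local Notation P := {mpoly K[n]}.
Implicit Types (I p q J : set P) (f g r : P) (m a : 'X_{1..n}).

Lemma le0m m : (0 <= m)%MM.
Proof. by apply/mnm_lepP => i; rewrite mnm0E. Qed.

Lemma lepmD m1 m2 m3 m4 :
  (m1 <= m3)%MM -> (m2 <= m4)%MM -> (m1 + m2 <= m3 + m4)%MM.
Proof.
move=> /mnm_lepP h1 /mnm_lepP h2; apply/mnm_lepP => i.
by rewrite !mnmDE leq_add.
Qed.

Definition mono I : set 'X_{1..n} := [set a | I 'X_[a]].

(** For an ideal this is a generator-free form of being monomial, convenient for powers and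
    associated primes. *)
Definition term_closed I := forall f m, I f -> m \in msupp f -> mono I m.

Lemma msupp_sum_ex (T : Type) (s : seq T) (F : T -> P) m :
  m \in msupp (\sum_(i <- s) F i) -> exists i, m \in msupp (F i).
Proof.
elim: s => [|i s IH]; first by rewrite big_nil msupp0.
by rewrite big_cons => /msuppD_le; rewrite mem_cat => /orP[|/IH//]; exists i.
Qed.

Lemma msuppM_ex f g m : m \in msupp (f * g) ->
  exists m1 m2, [/\ m1 \in msupp f, m2 \in msupp g & m = (m1 + m2)%MM].
Proof. by move/msuppM_le/allpairsP => [[m1 m2] [/= ? ? ->]]; exists m1, m2. Qed.

Lemma mono_up_closed I : is_ideal I -> up_closed (mono I).
Proof.
move=> [_ _ IM] a b Ia ab; rewrite /mono/= -(submK ab) mpolyXD; exact: IM.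
Qed.

Lemma mem_term_closed I f : is_ideal I ->
  (forall m, m \in msupp f -> mono I m) -> I f.
Proof.
move=> Iid If; rewrite [f]mpolyE big_seq; apply: ideal_sum => // m /If Im.
by rewrite -mul_mpolyC; case: Iid => _ _; exact.
Qed.

Lemma monomial_idealP I : monomial_ideal I -> is_ideal I /\ term_closed I.
Proof.
move=> [E IE]; have Iid : is_ideal I by rewrite IE; exact: ideal_gen_is_ideal.
split=> // f m; rewrite {1}IE => -[k [l [s [_ sE ->]]]] /msupp_sum_ex[i].
have [e Ee <-] := sE i => /msuppM_ex[m1 [m2 [_ /mem_msuppXP <- ->]]].
apply: (mono_up_closed Iid _ (lem_addl m1 e)).
by rewrite /mono/= IE; apply: sub_ideal_gen; exists e.
Qed.

Lemma ideal_pow_supp I k f m : term_closed I -> ideal_pow I k f ->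
  m \in msupp f -> minkowski_pow (mono I) k m.
Proof.
move=> Iterm [N [l [s [_ sI ->]]]] /msupp_sum_ex[i].
have [g gI ->] := sI i => /msuppM_ex[m1 [m2 [_ m2s ->]]] {sI}.
apply: (up_closed_minkowski_pow _ (lem_addl m1 m2)).
suff H (t : seq 'I_k) m' : m' \in msupp (\prod_(j <- t) g j) ->
    minkowski_pow (mono I) (size t) m'.
  by have := H _ _ m2s; rewrite -[size _]/(size _) -[index_enum _]enumT -cardE card_ord.
elim: t m' => [|j t IH] m'.
  by rewrite big_nil => _; exists [::]; split=> //; rewrite big_nil; exact: le0m.
rewrite big_cons => /msuppM_ex[a [b [ag /IH[u [su uI ub]] ->]]].
exists (a :: u); split=> [|c|]; first by rewrite /= su.
- by rewrite inE => /predU1P[->|/uI//]; exact: Iterm (gI j) ag.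
- by rewrite big_cons; exact: lepmD (lepm_refl a) ub.
Qed.

Lemma mono_ideal_pow I k : term_closed I ->
  mono (ideal_pow I k) = minkowski_pow (mono I) k.
Proof.
move=> Iterm; apply/seteqP; split=> a.
  by move=> h; apply: ideal_pow_supp h _ => //; rewrite msuppX mem_head.
move=> [s [sk sI sa]]; rewrite /mono/= -(submK sa) mpolyXD.
have [_ _] : is_ideal (ideal_pow I k) by exact: ideal_gen_is_ideal.
apply; apply: sub_ideal_gen; exists (fun i => 'X_[nth 0%MM s i]).
  by move=> i; apply: sI; rewrite mem_nth// sk.
by rewrite -sk -mpolyX_prod (big_nth 0%MM) big_mkord.
Qed.

Lemma term_closed_ideal_pow I k : term_closed I -> term_closed (ideal_pow I k).
Proof. by move=> It f m If mf; rewrite mono_ideal_pow//; exact: ideal_pow_supp If mf. Qed.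

Lemma prime_monoP p m : is_prime_ideal p ->
  mono p m <-> exists2 i, (m i != 0)%N & p 'X_i.
Proof.
move=> pp; have [[_ _ pM] p1 _] := pp; split.
  rewrite /mono/= mpolyXE_id => /(prime_ideal_prod pp)[i _ pi].
  exists i; last exact: prime_idealX pp pi.
  by apply/eqP => mi; move: pi; rewrite mi expr0.
move=> [i mi pi]; apply: (mono_up_closed _ pi) => //; first by case: pp.
apply/mnm_lepP => j; rewrite mnm1E; by case: eqP => // <-; rewrite lt0n.
Qed.

(** Denominators may be taken to be monomials: a polynomial outside p has a term outside p, and its
    product with ['X_[a]] is a term of an element of [J]. *)
Lemma mono_loc_contractionP J p a : is_ideal J -> term_closed J ->
  is_prime_ideal p -> mono (loc_contraction J p) a <->
  exists2 m, ~ mono p m & mono J (m + a)%MM.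
Proof.
move=> Jid Jt pp; rewrite /mono/= loc_contractionP//; split; last first.
  by move=> [m pm Jm]; exists 'X_[m]; rewrite -?mpolyXD.
move=> [s ps Js].
have [m ms pm] : exists2 m, m \in msupp s & ~ mono p m.
  apply: contrapT => h; apply: ps; apply: mem_term_closed; first by case: pp.
  by move=> m ms; apply: contrapT => pm; apply: h; exists m.
exists m => //; apply: (Jt _ _ Js).
by rewrite mcoeff_msupp addmC mcoeffMX -mcoeff_msupp.
Qed.

(* Split each exponent g of I into its part in the variables of p, which lies
   in the contraction of I, and the remaining part, which is invertible at p. *)
Lemma mono_loc_contraction_pow I p k : is_ideal I -> term_closed I ->
  is_prime_ideal p -> mono (loc_contraction (ideal_pow I k) p) =
  minkowski_pow (mono (loc_contraction I p)) k.
Proof.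
move=> Iid It pp; apply/seteqP; split=> a.
  case/mono_loc_contractionP => //; first exact: ideal_gen_is_ideal.
    exact: term_closed_ideal_pow.
  move=> m pm; rewrite mono_ideal_pow// => -[s [sk sI /mnm_lepP sa]].
  pose h (g : 'X_{1..n}) := [multinom if `[< p 'X_i >] then g i else 0%N | i < n].
  exists (map h s); split; first by rewrite size_map.
    move=> _ /mapP[g gs ->]; apply/mono_loc_contractionP => //.
    exists (g - h g)%MM.
      move=> /(prime_monoP _ pp)[i]; rewrite mnmBE mnmE => + pi.
      by rewrite asboolT// subnn eqxx.
    rewrite submK; first exact: sI.
    by apply/mnm_lepP => i; rewrite mnmE; case: ifP.
  apply/mnm_lepP => i; rewrite mnm_sumE big_map.
  under eq_bigr do rewrite mnmE.
  case: asboolP => pi; last by rewrite big1.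
  apply: leq_trans (_ : (m + a)%MM i <= _)%N; first by rewrite -mnm_sumE.
  rewrite mnmDE; suff -> : m i = 0%N by [].
  by apply: contrapT => /eqP mi; apply: pm; apply/prime_monoP => //; exists i.
move=> [s [sk sI sa]]; apply/mono_loc_contractionP => //.
- exact: ideal_gen_is_ideal.
- exact: term_closed_ideal_pow.
(* The product of the monomial denominators of the entries of s serves them all and is outside p by
   primality. *)
have [m pm [t [tk tI ts]]] : exists2 m, ~ mono p m &
    minkowski_pow (mono I) k (m + \sum_(b <- s) b)%MM.
  rewrite -sk; elim: s sI {sk sa} => [|b s IH] sI.
    exists 0%MM; first by rewrite /mono/= mpolyX0; case: pp.
    by exists [::]; split=> //; rewrite big_nil; exact: le0m.
  have [|m pm [t [tk tI ts]]] := IH.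
    by move=> c cs; apply: sI; rewrite inE cs orbT.
  have [m' pm' Im'] := (mono_loc_contractionP b Iid It pp).1 (sI b (mem_head _ _)).
  exists (m' + m)%MM.
    by rewrite /mono/= mpolyXD; case: pp => _ _ pM /pM[].
  exists ((m' + b)%MM :: t); split=> [|c|]; first by rewrite /= tk.
    by rewrite inE => /predU1P[->|/tI].
  rewrite !big_cons; move/mnm_lepP: ts => ts; apply/mnm_lepP => i.
  by move: (ts i); rewrite !mnmDE addnACA leq_add2l.
exists m => //; rewrite mono_ideal_pow//; exists t; split=> //.
exact: lepm_trans ts (lepmD (lepm_refl m) sa).
Qed.

Lemma mono_loc_contraction_anti J p q : is_ideal J -> term_closed J ->
  is_prime_ideal p -> is_prime_ideal q -> (forall i, p 'X_i -> q 'X_i) ->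
  mono (loc_contraction J q) `<=` mono (loc_contraction J p).
Proof.
move=> Jid Jt pp qq pq a /(mono_loc_contractionP a Jid Jt qq)[m qm Jm].
apply/mono_loc_contractionP => //; exists m => // /(prime_monoP _ pp)[i mi /pq pi].
by apply: qm; apply/prime_monoP => //; exists i.
Qed.

Lemma term_closed_prime_sub p q : is_prime_ideal p -> is_prime_ideal q ->
  term_closed p -> (forall i, p 'X_i -> q 'X_i) -> p `<=` q.
Proof.
move=> pp qq pt pq f pf; apply: mem_term_closed; first by case: qq.
move=> m /(pt _ _ pf)/(prime_monoP _ pp)[i mi /pq qi].
by apply/prime_monoP => //; exists i.
Qed.

(** * Associated primes of monomial ideals *)

Lemma size_msupp_rem f m : m \in msupp f ->
  (size (msupp (f - f@_m *: 'X_[m])) < size (msupp f))%N.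
Proof.
move=> mf; rewrite (perm_size (msupp_rem f m)) size_rem//.
by rewrite ltn_predL; case: (msupp f) mf.
Qed.

(** Subtracting the leading term, itself in p, leaves an element of p with fewer terms. *)
Lemma term_closed_mlead p : is_ideal p ->
  (forall r, p r -> r != 0 -> mono p (mlead r)) -> term_closed p.
Proof.
move=> pid plead r; have [k] := ubnP (size (msupp r)).
elim: k r => // k IH r + m pr mr; rewrite ltnS => rk.
have r0 : r != 0 by apply: contraTneq mr => ->; rewrite msupp0.
have pl := plead r pr r0.
have [->//|ml] := eqVneq m (mlead r).
apply: (IH (r - r@_(mlead r) *: 'X_[mlead r])).
- by apply: leq_trans rk; apply: size_msupp_rem; exact: mlead_supp.
- apply: idealB => //; rewrite -mul_mpolyC; case: pid => _ _; exact.
- by rewrite (perm_mem (msupp_rem _ _)) mem_rem_uniq ?msupp_uniq// inE ml.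
Qed.

(* If X^t is the leading monomial of some r in p = (I : f) but X^t is not in p,
   then p = (I : X^t f') where f' is f without its leading term: so the leading
   monomials of p lie in p when f has as few terms as possible. *)
Lemma Ass_term_closed I p : is_ideal I -> term_closed I -> Ass I p ->
  term_closed p.
Proof.
move=> Iid It [pp [f pf]]; have [pid p1 pM] := pp; have [I0 ID IM] := Iid.
have [k] := ubnP (size (msupp f)); elim: k f pf => // k IH f pf.
rewrite ltnS => fk.
have pE g : p g <-> I (g * f) by rewrite pf.
have f0 : f != 0 by apply/eqP => f0; apply: p1; apply/pE; rewrite f0 mulr0.
have [|/existsNP[r /not_implyP[pr /not_implyP[r0 pt]]]] :=
  pselect (forall r, p r -> r != 0 -> mono p (mlead r)).
  exact: term_closed_mlead.
set t := mlead r in pt; set l := mlead f.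
(* This product is the leading monomial of [r * f], which lies in the term-closed ideal [I]. *)
have Itl : I ('X_[t] * 'X_[l]).
  rewrite -mpolyXD -mleadM//; apply: (It (r * f)); first exact/pE.
  by rewrite mlead_supp// mulf_neq0.
pose f' := f - f@_l *: 'X_[l].
have fE : f = f' + f@_l *: 'X_[l] by rewrite subrK.
have Ic g : I (g * (f@_l *: 'X_[l] * 'X_[t])).
  apply: (IM); rewrite -mul_mpolyC -mulrA; apply: IM.
  by rewrite mulrC.
apply: (IH (f' * 'X_[t])).
  apply/seteqP; split=> g.
    move=> /pE Igf; rewrite /ideal_colon/=.
    rewrite (_ : _ * _ = 'X_[t] * (g * f) - g * (f@_l *: 'X_[l] * 'X_[t])).
      by apply: idealB => //; exact: IM.
    by rewrite {1}fE; ring.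
  rewrite /ideal_colon/= => Igf'.
  (* Primality cancels ['X_[t]], which is not in p. *)
  suff /pM[] : p ('X_[t] * g) by [].
  apply/pE.
  rewrite (_ : _ * _ = g * (f' * 'X_[t]) + g * (f@_l *: 'X_[l] * 'X_[t])).
    exact: ID.
  by rewrite {1}fE; ring.
rewrite (perm_size (msuppMX _ _)) size_map.
by apply: leq_trans fk; apply: size_msupp_rem; exact: mlead_supp.
Qed.

(** * Maximal associated primes and symbolic powers *)

Definition vars_in p : {set 'I_n} := [set i | `[< p 'X_i >]]%SET.

Lemma vars_inP p i : reflect (p 'X_i) (i \in vars_in p).
Proof. by rewrite inE; exact: asboolP. Qed.

(** Associated primes are determined by their variables, so a strict inclusion adds a variable,
    which can happen at most n times. *)
Lemma sub_maxAss I p : is_ideal I -> term_closed I -> Ass I p ->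
  exists2 q, maxAss I q & p `<=` q.
Proof.
move=> Iid It; have [k] := ubnP (n - #|vars_in p|)%N.
elim: k p => // k IH p + Ap; rewrite ltnS => pk.
have [pmax|pmax] := pselect (maxAss I p); first by exists p.
have [q [Aq pq qp]] : exists q, [/\ Ass I q, p `<=` q & q <> p].
  apply: contrapT => h; apply: pmax; split=> // q Aq pq.
  by apply: contrapT => qp; apply: h; exists q.
have [s sm qs] : exists2 s, maxAss I s & q `<=` s.
  apply: IH => //; apply: leq_trans pk.
  suff : (#|vars_in p| < #|vars_in q|)%N.
    have : (#|vars_in q| <= n)%N by rewrite -[leqRHS]card_ord max_card.
    by move=> qn pq_lt; apply: ltn_sub2l => //; apply: leq_trans pq_lt qn.
  apply: proper_card; apply/properP; split.
    by apply/fintype.subsetP => i /vars_inP/pq/vars_inP.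
  apply: contrapT => h; apply: qp; apply/seteqP; split=> //.
  apply: term_closed_prime_sub; [by case: Aq|by case: Ap| |].
    exact: Ass_term_closed Aq.
  move=> i qi; apply: contrapT => pi; apply: h.
  by exists i; apply/vars_inP.
by exists s => //; exact: subset_trans pq qs.
Qed.

(** Indexing by sets of variables gives the finite index type that [uniform_scaling] requires. A set
    that comes from no maximal associated prime imposes no condition. *)
Definition component_exponents I (S : {set 'I_n}) : set 'X_{1..n} :=
  [set a | forall p, maxAss I p -> vars_in p = S ->
     mono (loc_contraction I p) a].

Lemma loc_contraction_up_closed I p : is_ideal I -> is_prime_ideal p ->
  up_closed (mono (loc_contraction I p)).
Proof.
move=> Iid pp a b /(loc_contractionP _ Iid pp)[s ps Is] ab.
apply/loc_contractionP => //; exists s => //.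
by rewrite -(submK ab) mpolyXD mulrCA; case: Iid => _ _; exact.
Qed.

Lemma maxAss_prime I p : maxAss I p -> is_prime_ideal p.
Proof. by case=> -[]. Qed.

Lemma component_exponents_up_closed I S : is_ideal I ->
  up_closed (component_exponents I S).
Proof.
move=> Iid a b Qa ab p mp pS.
by apply: (loc_contraction_up_closed Iid _ (Qa p mp pS) ab); exact: maxAss_prime mp.
Qed.

Lemma component_exponentsE I p : is_ideal I -> term_closed I -> maxAss I p ->
  component_exponents I (vars_in p) = mono (loc_contraction I p).
Proof.
move=> Iid It mp; apply/seteqP; split=> a; first exact.
move=> Qa q mq qp; apply: mono_loc_contraction_anti Qa => //.
- exact: maxAss_prime mq.
- exact: maxAss_prime mp.
- by move=> i /vars_inP; rewrite qp => /vars_inP.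
Qed.

Lemma component_exponentsT I S : ~ (exists2 p, maxAss I p & vars_in p = S) ->
  component_exponents I S = setT.
Proof.
by move=> h; apply/seteqP; split=> // a _ p mp pS; case: h; exists p.
Qed.

Lemma mono_symbolic_power I k : is_ideal I -> term_closed I ->
  mono (symbolic_power I k) =
  [set a | forall S, minkowski_pow (component_exponents I S) k a].
Proof.
move=> Iid It; apply/seteqP; split=> a h.
  move=> S; have [[p mp <-]|nS] :=
    pselect (exists2 p, maxAss I p & vars_in p = S).
    rewrite component_exponentsE// -mono_loc_contraction_pow//.
      by apply: h; case: mp.
    exact: maxAss_prime mp.
  rewrite component_exponentsT//; exists (nseq k 0%MM); split=> //.
    by rewrite size_nseq.
  by rewrite big1_seq => [|m /andP[_ /nseqP[]]//]; exact: le0m.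
(* A maximal prime containing p allows fewer denominators, so its condition implies the one at p. *)
move=> p Ap; have [q mq pq] := sub_maxAss Iid It Ap.
have pp : is_prime_ideal p by case: Ap.
have qq := maxAss_prime mq.
apply: (@mono_loc_contraction_anti _ p q) => //.
- exact: ideal_gen_is_ideal.
- exact: term_closed_ideal_pow.
- by move=> i; exact: pq.
- by rewrite mono_loc_contraction_pow// -component_exponentsE//; exact: h.
Qed.

Lemma symbolic_polyhedronE (R : realType) I : is_ideal I -> term_closed I ->
  symbolic_polyhedron R I = [set x | nonneg_orthant x /\ forall S,
    convex_hull (exponent_vector R @` component_exponents I S) x].
Proof.
move=> Iid It; apply/seteqP; split=> x [x0 hx]; split=> //.
  move=> S; have [[p mp <-]|nS] :=
    pselect (exists2 p, maxAss I p & vars_in p = S).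
    by rewrite component_exponentsE//; exact: hx.
  (* The hull of all exponents contains 0, hence the whole nonnegative orthant. *)
  rewrite component_exponentsT// -[x]add0r; apply: convex_hull_up_closed => //.
  apply: sub_convex_hull; exists 0%MM => //.
  by apply/rowP => i; rewrite !mxE mnm0E.
by move=> p mp; have := hx (vars_in p); rewrite component_exponentsE.
Qed.

End MonomialTheory.

Theorem theorem5p1 (K : fieldType) (R : realType) (n : nat)
    (I : set {mpoly K[n]}) (hI : monomial_ideal I) :
  exists c : nat, (0 < c)%N /\
    newton_polyhedron R (symbolic_power I c) =
    [set c%:R *: v | v in symbolic_polyhedron R I].
Proof.
have [Iid It] := monomial_idealP hI.
pose Q := component_exponents I.
have [c c0 hc] := uniform_scaling R Q.
have cR : c%:R != 0 :> R by rewrite pnatr_eq0 -lt0n.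
exists c; split=> //.
rewrite /newton_polyhedron -/(mono _) mono_symbolic_power//.
rewrite symbolic_polyhedronE//; apply/seteqP; split=> [x hx|_ [x [x0 hx] <-]];
  last exact: hc.
exists (c%:R^-1 *: x); last by rewrite scalerA divff// scale1r.
(* The dilated symbolic polyhedron is convex, so only the exponents of the symbolic power need to be
   tested; this inclusion uses only that c is positive. *)
move: x hx; apply: (@convex_hull_min _ _ _ [set x : 'rV[R]_n |
    nonneg_orthant (c%:R^-1 *: x) /\
    forall S, convex_hull (exponent_vector R @` Q S) (c%:R^-1 *: x)]).
  apply: (@convex_setZ R n [set x | nonneg_orthant x /\
    forall S, convex_hull (exponent_vector R @` Q S) x]).
  apply/convex_setP => x y t t0 t1 [x0 hx] [y0 hy]; split=> [i|S].
    by rewrite !mxE addr_ge0// mulr_ge0// subr_ge0.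
  by have /convex_setP := @convex_convex_hull _ _ (exponent_vector R @` Q S); apply.
move=> _ [a ha <-]; split=> [i|S]; first by rewrite !mxE mulr_ge0// invr_ge0.
by apply: minkowski_pow_sub => //; exact: component_exponents_up_closed.
Qed.
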